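(* Let $\{(\mathcal C_n,\mathcal N_n)\}_{n\ge1}$ be a family of codes of dimension $K_n$ with encoding maps $\mathcal E_n$ and noise channels $\mathcal N_n$, and let $S_n=S(\Lambda_n+B_n\|\Lambda_n)$ be the corresponding AQEC relative entropies. Then: (1) If $\lim_{n\to\infty}S_n=0$, there exists a family of recovery channels $\{\mathcal R_n\}$ with $\lim_{n\to\infty}F_e(\mathcal R_n\circ\mathcal N_n\circ\mathcal E_n)=1$. (2) If $K_n=O(1)$ and $S_n$ does not converge to $0$, then for every family of recovery channels $\{\mathcal R_n\}$, $F_e(\mathcal R_n\circ\mathcal N_n\circ\mathcal E_n)$ does not converge to $1$. (3) If $K_n\to\infty$ and $s_n:=S_n/\log K_n$ does not converge to $0$, then for every family of recovery channels $\{\mathcal R_n\}$, $F_e(\mathcal R_n\circ\mathcal N_n\circ\mathcal E_n)$ does not converge to $1$.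
   Context: For each $n$: $\mathcal H_n$ is a finite-dimensional Hilbert space, $\mathcal C_n\subseteq\mathcal H_n$ a code subspace of dimension $K_n$ with orthonormal basis $\{|q\rangle\}$, encoding $\mathcal E_n(\rho)=V_n\rho V_n^\dagger$ with $V_n:\mathbb C^{K_n}\to\mathcal H_n$ the isometry onto $\mathcal C_n$ sending the standard basis to $\{|q\rangle\}$, and $\mathcal N_n(\rho)=\sum_u E_u\rho E_u^\dagger$ a CPTP noise channel. With $P$ the projector onto $\mathcal C_n$, write $PE_u^\dagger E_vP=\lambda_{uv}P+PB_{uv}P$ where $\lambda_{uv}=\frac1{K_n}\mathrm{tr}(PE_u^\dagger E_vP)$; define matrices with rows indexed by $(u,q_1)$ and columns by $(v,q_2)$: $(\Lambda_n)_{uv,q_1q_2}=\lambda_{uv}\delta_{q_1q_2}/K_n$, $(B_n)_{uv,q_1q_2}=\langle q_1|B_{uv}|q_2\rangle/K_n$. The AQEC relative entropy is $S(\Lambda+B\|\Lambda)=\mathrm{tr}\{(\Lambda+B)[\log(\Lambda+B)-\log\Lambda]\}$. A recovery channel $\mathcal R_n$ is a CPTP map from operators on $\mathcal H_n$ to operators on $\mathbb C^{K_n}$. $F_e(\Phi)=\sum_i|\mathrm{tr}(A_i)/K|^2$ is the entanglement fidelity of a channel $\Phi$ on $\mathbb C^K$ with Kraus operators $\{A_i\}$, relative to the maximally mixed state $I_K/K$. *)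

(* Defs.v *)
From HB Require Import structures.
From mathcomp Require Import all_boot all_order all_algebra.
From mathcomp Require Import complex.
From mathcomp Require Import reals exp sequences topology normedtype.

Set Implicit Arguments.
Unset Strict Implicit.
Unset Printing Implicit Defensive.

Import Order.TTheory GRing.Theory Num.Theory.
Local Open Scope ring_scope.

Section QEC.
Variable R : realType.
Local Notation C := R[i].

Definition adjmx (p q : nat) (A : 'M[C]_(p, q)) : 'M[C]_(q, p) :=
  (map_mx Num.conj A)^T.

Definition is_isometry (d K : nat) (V : 'M[C]_(d, K)) : Prop :=
  adjmx V *m V = 1%:M.

Definition kraus_tp (r p q : nat) (A : 'I_r -> 'M[C]_(p, q)) : Prop :=
  \sum_(i < r) adjmx (A i) *m A i = 1%:M.

(* Matrix functional calculus for Hermitian (normal) matrices via the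
   spectral decomposition A = U^-1 diag(x) U of spectral.v. *)
Definition mxfun (n : nat) (f : C -> C) (A : 'M[C]_n) : 'M[C]_n :=
  invmx (spectralmx A) *m diag_mx (map_mx f (spectral_diag A)) *m spectralmx A.

(* logarithm on the support (convention: log 0 := 0), natural log *)
Definition clog (z : C) : C := if 0 < complex.Re z then (ln (complex.Re z))%:C%C else 0.

Definition mxlog (n : nat) (A : 'M[C]_n) : 'M[C]_n := mxfun clog A.

Definition relent (n : nat) (rho sigma : 'M[C]_n) : R :=
  complex.Re (\tr (rho *m (mxlog rho - mxlog sigma))).

Section Code.
Variables (d K m : nat).
Variable V : 'M[C]_(d, K).            (* encoding isometry onto the code *)
Variable E : 'I_m -> 'M[C]_d.         (* Kraus operators of the noise *)

Definition code_proj : 'M[C]_d := V *m adjmx V.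
Local Notation P := code_proj.

Definition lambda_uv (u v : 'I_m) : C :=
  \tr (P *m adjmx (E u) *m E v *m P) / K%:R.

(* a choice of B_uv with P E_u^dag E_v P = lambda_uv P + P B_uv P *)
Definition B_uv (u v : 'I_m) : 'M[C]_d :=
  P *m adjmx (E u) *m E v *m P - lambda_uv u v *: P.

Definition pidx (k : 'I_(m * K)) : 'I_m * 'I_K :=
  pair_of_mxvec_index (mxvec_indexP k).

Definition Lambda_mx : 'M[C]_(m * K) :=
  \matrix_(k, l) (lambda_uv (pidx k).1 (pidx l).1
                  * ((pidx k).2 == (pidx l).2)%:R / K%:R).

(* <q1| B_uv |q2> = (V^dag B_uv V)_{q1 q2} *)
Definition B_mx : 'M[C]_(m * K) :=
  \matrix_(k, l) ((adjmx V *m B_uv (pidx k).1 (pidx l).1 *m V)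
                    (pidx k).2 (pidx l).2 / K%:R).

Definition aqec_S : R := relent (Lambda_mx + B_mx) Lambda_mx.

(* entanglement fidelity of R o N o E, for a recovery channel with Kraus
   operators Rc i : C^d -> C^K; Kraus operators of the composite are
   Rc i * E u * V. *)
Definition ent_fid (r : nat) (Rc : 'I_r -> 'M[C]_(K, d)) : R :=
  \sum_(i < r) \sum_(u < m) complex.Re (`| \tr (Rc i *m E u *m V) / K%:R | ^+ 2).

End Code.
End QEC.

(* Main.v *)
Require Import Defs.
From HB Require Import structures.
From mathcomp Require Import all_boot all_order all_algebra.
From mathcomp Require Import complex ring lra.
From mathcomp Require Import reals exp sequences topology normedtype.

Import Order.TTheory GRing.Theory Num.Theory.
Import numFieldTopology.Exports numFieldNormedType.Exports.
Local Open Scope ring_scope.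
Local Open Scope classical_set_scope.

Set Implicit Arguments.
Unset Strict Implicit.
Unset Printing Implicit Defensive.

(* Let M be the d x mK matrix with columns E_u V e_q, and put N = M / sqrt K. Then
   Lambda + B = N^* N, while Lambda = lambda (x) I / K, where lambda is the partial
   trace of N^* N over the code index.  With spectral decompositions
   N^* N = sum_i p_i |i><i| and Lambda = sum_j s_j |j><j|, the relative entropy is the
   expectation of ln (p_i / s_j) under the probability weights p_i |<i|j>|^2.

   (1) ln (p / s) >= 2 (1 - sqrt (s / p)) gives S >= 2 (1 - A) with
   A = tr (sqrt (Lambda + B) sqrt Lambda).  The adjoint of the partial isometry in the
   polar decomposition of N, completed to a channel, is a recovery for which the
   inner product with sqrt lambda (x) I / sqrt K is A; hence F_e >= 2 A - 1 >= 1 - S.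

   (2), (3) For a recovery with Kraus operators R_i, subtracting from each R_i E_u V
   its average trace exhibits factorizations N'^* N' = Lambda + B and
   L'^* L' = Lambda with |N' - L'|^2 = 2 (1 - F_e) in Frobenius norm, so that
   sum |<i|j>|^2 (sqrt p_i - sqrt s_j)^2 <= 8 (1 - F_e).  Cauchy-Schwarz gives
   Lambda + B <= K^2 Lambda, so p_i / s_j has mean at most K^2.  Splitting the
   expectation of ln (p_i / s_j) according to whether s_j / p_i is close to 1 yields
   S <= 3 eta + 8 (1 - F_e) (6 / eta + 8 ln K) for every eta in ]0, 1], a bound that
   does not involve the dimension of the environment. *)

(** * Pointwise estimates *)

Lemma ln_le_subr1 (R : realType) (z : R) : 0 < z -> ln z <= z - 1.
Proof.
move=> z0; have := @le_ln1Dx R (z - 1).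
by rewrite [1 + _]addrC subrK; apply; rewrite ltrBrDr addNr.
Qed.

(** This is [ln z <= z - 1] at [z = sqrt (s / p)], multiplied by [2 c p]. The last hypothesis makes
    both sides vanish at [s = 0], where [ln] has the default value 0. *)
Lemma relent_term_ge (R : realType) (c p s : R) :
  0 <= c -> 0 <= p -> 0 <= s -> (s = 0 -> c * p = 0) ->
  2 * (c * p - c * (Num.sqrt p * Num.sqrt s)) <= c * (p * (ln p - ln s)).
Proof.
move=> c0 p0 s0 H.
have [->|pn] := eqVneq p 0; first by rewrite sqrtr0 !mul0r !mulr0 subr0 mulr0.
have [sz|sn] := eqVneq s 0.
  by rewrite sz sqrtr0 !mulr0 mulrA (H sz) mul0r subr0 mulr0.
have pp : 0 < p by rewrite lt_neqAle eq_sym pn.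
have sp : 0 < s by rewrite lt_neqAle eq_sym sn.
set a := Num.sqrt p; set b := Num.sqrt s.
have ap : 0 < a by rewrite sqrtr_gt0.
have bp : 0 < b by rewrite sqrtr_gt0.
have pE : p = a ^+ 2 by rewrite sqr_sqrtr.
have sE : s = b ^+ 2 by rewrite sqr_sqrtr.
rewrite pE sE !lnXn //.
have L : ln b - ln a <= b / a - 1.
  rewrite -ln_div ?posrE //.
  by rewrite ln_le_subr1 // divr_gt0.
have L2 : a ^+ 2 * (ln b - ln a) <= a * b - a ^+ 2.
  have -> : a * b - a ^+ 2 = a ^+ 2 * (b / a - 1) by field; rewrite gt_eqF.
  by rewrite ler_wpM2l // sqr_ge0.
have {}L2 := ler_wpM2l c0 L2.
rewrite !mulr2n; move: L2; clearbody a b.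
move: (ln a) (ln b) => la lb L2; lra.
Qed.

(** Put [x = sqrt (s / p)]. For [|1 - x| <= 1/2] the terms in [eta] suffice. Otherwise [4 (1 - x)^2]
    exceeds 1 and pays for [ln u], while the last term bounds the remaining [ln (p / (u s))]. *)
Lemma relent_term_le (R : realType) (eta u c p s : R) :
  0 < eta -> 1 <= u -> 0 <= c -> 0 <= p -> 0 <= s -> (s = 0 -> c * p = 0) ->
  c * (p * (ln p - ln s)) <=
    2 * eta * (c * p)
    + (2 / eta + 4 * ln u) * (c * (Num.sqrt p - Num.sqrt s) ^+ 2)
    + u^-1 * (p * (c * p / s)).
Proof.
move=> e0 u1 c0 p0 s0 H.
have u0 : 0 < u by apply: lt_le_trans u1.
have lu : 0 <= ln u by apply: ln_ge0.
have ie : 0 <= 2 / eta by rewrite divr_ge0 // ltW.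
have T0 : 0 <= 2 / eta + 4 * ln u by rewrite addr_ge0 // mulr_ge0.
have T1 : 0 <= (2 / eta + 4 * ln u) * (c * (Num.sqrt p - Num.sqrt s) ^+ 2).
  by rewrite mulr_ge0 // mulr_ge0 // sqr_ge0.
have [pz|pn] := eqVneq p 0.
  by rewrite pz in T1 *; rewrite !mul0r !mulr0 addr0 add0r.
have [sz|sn] := eqVneq s 0.
  have cp := H sz; rewrite mulrA !cp !mul0r !mulr0 addr0 add0r.
  exact: T1.
have pp : 0 < p by rewrite lt_neqAle eq_sym pn.
have sp : 0 < s by rewrite lt_neqAle eq_sym sn.
set a := Num.sqrt p in T1 *; set b := Num.sqrt s in T1 *.
have ap : 0 < a by rewrite sqrtr_gt0.
have bp : 0 < b by rewrite sqrtr_gt0.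
have pE : p = a ^+ 2 by rewrite sqr_sqrtr.
have sE : s = b ^+ 2 by rewrite sqr_sqrtr.
suff F : ln p - ln s <= 2 * eta + (2 / eta + 4 * ln u) * (1 - b / a) ^+ 2
   + u^-1 * (p / s).
  have := ler_wpM2l (mulr_ge0 c0 p0) F.
  rewrite mulrA => /le_trans; apply.
  rewrite le_eqVlt; apply/orP; left; apply/eqP.
  by rewrite pE sE; field; rewrite !gt_eqF.
have x0 : 0 < b / a by rewrite divr_gt0.
have xE : p / s = (b / a) ^- 2 by rewrite pE sE; field; rewrite !gt_eqF.
rewrite -ln_div ?posrE // xE; set x := b / a in x0 *.
have ix : 0 < x^-1 by rewrite invr_gt0.
have x2 : 0 < x ^- 2 by rewrite invr_gt0 exprn_gt0.
have last0 : 0 <= u^-1 * x ^- 2 by apply: mulr_ge0; [rewrite invr_ge0|]; apply: ltW.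
have sq0 : 0 <= (1 - x) ^+ 2 by apply: sqr_ge0.
have [near|far] := lerP (4 * (1 - x) ^+ 2) 1.
  have xh : 1 / 2 <= x.
    have [//|xlt] := lerP (1 / 2) x.
    have : 0 < (1 / 2 - x) * (3 / 2 - x) by rewrite mulr_gt0 // subr_gt0 //; lra.
    move: near; rewrite !expr2; lra.
  have A1 : ln (x ^- 2) <= 2 * (x^-1 - 1).
    by rewrite -exprVn lnXn // -[ln _ *+ 2]mulr_natl ler_wpM2l // ln_le_subr1.
  have A2 : 2 * (x^-1 - 1) <= 2 * eta + 2 / eta * (1 - x) ^+ 2.
    have [x1|x1] := lerP 1 x.
      have : x^-1 <= 1 by rewrite invf_le1.
      have := mulr_ge0 ie sq0; move: e0; lra.
    have A3 : x^-1 - 1 <= 2 * (1 - x).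
      have -> : x^-1 - 1 = x^-1 * (1 - x) by field; rewrite gt_eqF.
      rewrite ler_wpM2r //; first lra.
      by rewrite -[leRHS]invrK lef_pV2 ?posrE ?invr_gt0 //; lra.
    (* Completing the square: the right side exceeds [4 (1 - x)] by a nonnegative multiple of a
       square. *)
    have -> : 2 * eta + 2 / eta * (1 - x) ^+ 2 =
      4 * (1 - x) + 2 / eta * (eta - (1 - x)) ^+ 2 by field; rewrite gt_eqF.
    have := mulr_ge0 ie (sqr_ge0 (eta - (1 - x))); lra.
  have := mulr_ge0 lu sq0; lra.
have pos : 0 < u^-1 * x ^- 2 by rewrite mulr_gt0 // invr_gt0.
have -> : ln (x ^- 2) = ln u + ln (u^-1 * x ^- 2).
  by rewrite -lnM ?posrE //; congr ln; field; rewrite !gt_eqF.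
have := ln_le_subr1 pos.
have := mulr_ge0 ie sq0.
have : ln u <= 4 * ln u * (1 - x) ^+ 2.
  by rewrite mulrAC ler_peMl // ltW.
move: e0; lra.
Qed.

(** * Matrices over the complex numbers *)

Section ComplexMatrices.
Variable R : realType.
Local Notation C := R[i].
Local Notation rc := (real_complex R).

(** The squared modulus, valued in [R] so that estimates stay in the real field. *)
Definition nsq (z : C) : R := complex.Re z ^+ 2 + complex.Im z ^+ 2.

Lemma nsqE (z : C) : rc (nsq z) = `|z| ^+ 2.
Proof. exact: add_Re2_Im2. Qed.

Lemma rcI (x y : R) : rc x = rc y -> x = y.
Proof. exact: complexI. Qed.

Lemma conj_rc (x : R) : Num.conj (rc x) = rc x.
Proof. exact: conjc_real. Qed.

Lemma Re_rc (x : R) : complex.Re (rc x) = x.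
Proof. by []. Qed.

Lemma nsq_conj (z : C) : rc (nsq z) = z^* * z.
Proof. by rewrite nsqE normCK mulrC. Qed.

Lemma nsq_ge0 z : 0 <= nsq z.
Proof. by rewrite addr_ge0 // sqr_ge0. Qed.

Lemma nsqM : {morph nsq : x y / x * y}.
Proof. by move=> x y; apply: rcI; rewrite rmorphM /= !nsqE normrM exprMn. Qed.

Lemma nsq_rc (x : R) : nsq (rc x) = x ^+ 2.
Proof. by rewrite /nsq /= expr0n addr0. Qed.

Lemma nsq0 : nsq 0 = 0.
Proof. by rewrite /nsq /= expr0n addr0. Qed.

Lemma nsq_conjC z : nsq z^* = nsq z.
Proof. by apply: rcI; rewrite !nsqE norm_conjC. Qed.

Lemma nsqN z : nsq (- z) = nsq z.
Proof. by apply: rcI; rewrite !nsqE normrN. Qed.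

Lemma nsq_eq0 z : (nsq z == 0) = (z == 0).
Proof.
by rewrite -(inj_eq rcI) rmorph0 nsqE sqrf_eq0 normr_eq0.
Qed.

Lemma nsqD_le x y : nsq (x + y) <= 2 * nsq x + 2 * nsq y.
Proof.
case: x => a b; case: y => c d; rewrite /nsq /=.
have := sqr_ge0 (a - c); have := sqr_ge0 (b - d).
rewrite !expr2; lra.
Qed.

Lemma nsq_conjr z : rc (nsq z) = z * z^*.
Proof. by rewrite nsq_conj mulrC. Qed.

Lemma nsqB x y : nsq (x - y) = nsq x + nsq y - 2 * complex.Re (x * y^*).
Proof. by case: x => a b; case: y => c d; rewrite /nsq /=; ring. Qed.

Lemma Re_sum (I : Type) (r : seq I) (P : pred I) (F : I -> C) :
  complex.Re (\sum_(i <- r | P i) F i) = \sum_(i <- r | P i) complex.Re (F i).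
Proof.
elim/big_rec2: _ => // i x y _ <-.
by case: (F i) => a b; case: y.
Qed.

Lemma adjmxE p q (A : 'M[C]_(p, q)) i j : adjmx A i j = (A j i)^*.
Proof. by rewrite !mxE. Qed.

Lemma adjmxK p q (A : 'M[C]_(p, q)) : adjmx (adjmx A) = A.
Proof. by apply/matrixP=> i j; rewrite !adjmxE conjCK. Qed.

Lemma adjmxD p q (A B : 'M[C]_(p, q)) : adjmx (A + B) = adjmx A + adjmx B.
Proof. by apply/matrixP=> i j; rewrite !mxE rmorphD. Qed.

Lemma adjmxN p q (A : 'M[C]_(p, q)) : adjmx (- A) = - adjmx A.
Proof. by apply/matrixP=> i j; rewrite !mxE rmorphN. Qed.

Lemma adjmxB p q (A B : 'M[C]_(p, q)) : adjmx (A - B) = adjmx A - adjmx B.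
Proof. by rewrite adjmxD adjmxN. Qed.

Lemma adjmxZ p q (a : C) (A : 'M[C]_(p, q)) : adjmx (a *: A) = a^* *: adjmx A.
Proof. by apply/matrixP=> i j; rewrite !mxE rmorphM. Qed.

Lemma adjmxM p q r (A : 'M[C]_(p, q)) (B : 'M_(q, r)) :
  adjmx (A *m B) = adjmx B *m adjmx A.
Proof. by rewrite /adjmx map_mxM trmx_mul. Qed.

Lemma adjmx1 n : adjmx 1%:M = 1%:M :> 'M[C]_n.
Proof. by rewrite /adjmx map_mx1 trmx1. Qed.

Lemma mxtrace_adj n (A : 'M[C]_n) : \tr (adjmx A) = (\tr A)^*.
Proof. by rewrite /mxtrace rmorph_sum; apply: eq_bigr => i _; rewrite adjmxE. Qed.

Definition fnorm2 p q (A : 'M[C]_(p, q)) : R := \sum_i \sum_j nsq (A i j).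

Lemma fnorm2_ge0 p q (A : 'M[C]_(p, q)) : 0 <= fnorm2 A.
Proof. by do 2![apply: sumr_ge0 => ? _]; apply: nsq_ge0. Qed.

Lemma tr_gram p q (A : 'M[C]_(p, q)) : \tr (adjmx A *m A) = rc (fnorm2 A).
Proof.
rewrite /fnorm2 exchange_big rmorph_sum /=; apply: eq_bigr => i _.
rewrite mxE rmorph_sum /=; apply: eq_bigr => j _.
by rewrite adjmxE nsq_conj.
Qed.

Lemma fnorm2_adj p q (A : 'M[C]_(p, q)) : fnorm2 (adjmx A) = fnorm2 A.
Proof.
rewrite /fnorm2 exchange_big; apply: eq_bigr => i _; apply: eq_bigr => j _.
by rewrite adjmxE nsq_conjC.
Qed.

Lemma fnorm2N p q (A : 'M[C]_(p, q)) : fnorm2 (- A) = fnorm2 A.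
Proof.
by apply: eq_bigr => i _; apply: eq_bigr => j _; rewrite mxE nsqN.
Qed.

Lemma fnorm2_col_mx p1 p2 q (A : 'M[C]_(p1, q)) (B : 'M[C]_(p2, q)) :
  fnorm2 (col_mx A B) = fnorm2 A + fnorm2 B.
Proof.
rewrite /fnorm2 big_split_ord /=; congr (_ + _); apply: eq_bigr => i _;
  by apply: eq_bigr => j _; rewrite ?col_mxEu ?col_mxEd.
Qed.

Lemma fnorm2_isometry p q r (U : 'M[C]_(r, p)) (A : 'M[C]_(p, q)) :
  adjmx U *m U = 1%:M -> fnorm2 (U *m A) = fnorm2 A.
Proof.
move=> UU; apply: rcI; rewrite -!tr_gram adjmxM -mulmxA (mulmxA _ U) UU.
by rewrite mul1mx.
Qed.

Lemma fnorm2_Z p q (a : C) (A : 'M[C]_(p, q)) : fnorm2 (a *: A) = nsq a * fnorm2 A.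
Proof.
rewrite /fnorm2 mulr_sumr; apply: eq_bigr => i _; rewrite mulr_sumr.
by apply: eq_bigr => j _; rewrite mxE nsqM.
Qed.

Lemma fnorm2_colE q (x : 'cV[C]_q) : fnorm2 x = \sum_i nsq (x i 0).
Proof. by apply: eq_bigr => i _; rewrite big_ord1. Qed.

(** Pythagoras for the orthogonal projection [T]. *)
Lemma fnorm2_proj_le p q (T : 'M[C]_p) (A : 'M[C]_(p, q)) :
  adjmx T = T -> T *m T = T -> fnorm2 (T *m A) <= fnorm2 A.
Proof.
move=> Th TT; suff -> : fnorm2 A = fnorm2 (T *m A) + fnorm2 (A - T *m A).
  by rewrite lerDl fnorm2_ge0.
apply: rcI; rewrite rmorphD /= -!tr_gram -mxtraceD; congr (\tr _).
rewrite adjmxB !adjmxM Th mulmxBl !mulmxBr -!mulmxA !(mulmxA T T) TT.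
by rewrite subrr subr0 addrC subrK.
Qed.

Definition diagc n (x : 'I_n -> R) : 'M[C]_n := diag_mx (\row_i rc (x i)).

Lemma mul_diagc n q (x : 'I_n -> R) (A : 'M_(n, q)) i j :
  (diagc x *m A) i j = rc (x i) * A i j.
Proof. by rewrite mul_diag_mx !mxE. Qed.

Lemma mul_mx_diagc n q (x : 'I_n -> R) (A : 'M_(q, n)) i j :
  (A *m diagc x) i j = A i j * rc (x j).
Proof. by rewrite mul_mx_diag !mxE. Qed.

Lemma diagcM n (x y : 'I_n -> R) :
  diagc x *m diagc y = diagc (fun i => x i * y i).
Proof.
apply/matrixP=> i j; rewrite mul_diagc !mxE.
by case: eqP => [->|]; rewrite ?mulr1n ?mulr0n ?mulr0 // rmorphM.
Qed.

Lemma adjmx_diagc n (x : 'I_n -> R) : adjmx (diagc x) = diagc x.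
Proof.
apply/matrixP=> i j; rewrite !mxE eq_sym.
by case: eqP => [->|]; rewrite ?mulr1n ?mulr0n ?conj_rc ?rmorph0.
Qed.

Lemma eq_diagc n (x y : 'I_n -> R) : x =1 y -> diagc x = diagc y.
Proof. by move=> xy; congr diag_mx; apply/rowP=> i; rewrite !mxE xy. Qed.

(** * Spectral decompositions and functional calculus *)

(** The rows of [U] are the adjoints of an orthonormal eigenbasis. Leaving [U] free permits bases
    other than [spectralmx], such as product bases. *)
Definition diagonalizes n (A U : 'M[C]_n) (x : 'I_n -> R) :=
  [/\ U *m adjmx U = 1%:M, adjmx U *m U = 1%:M
    & A = adjmx U *m diagc x *m U].

Lemma spectralmx_adj n (A : 'M[C]_n) :
  spectralmx A *m adjmx (spectralmx A) = 1%:M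
  /\ invmx (spectralmx A) = adjmx (spectralmx A).
Proof.
have sU := spectral_unitarymx A.
have E : adjmx (spectralmx A) = trmx (map_mx Num.conj (spectralmx A)) by [].
split; first by rewrite E; have /unitarymxP := sU; rewrite map_trmx.
by rewrite invmx_unitary // E map_trmx.
Qed.

Lemma diagonalizes_spectral n (A U : 'M[C]_n) x :
  diagonalizes A U x ->
  A = invmx (spectralmx A) *m diag_mx (spectral_diag A) *m spectralmx A.
Proof.
move=> [UU _ AE]; apply/orthomx_spectralP; apply/normalmxP.
have Ah : adjmx A = A by rewrite AE !adjmxM adjmxK adjmx_diagc mulmxA.
by move: Ah; rewrite /adjmx -map_trmx => ->.
Qed.

(** The unitary [W] between the two eigenbases intertwines the two diagonal matrices, so [W i j] is
    nonzero only where the eigenvalues agree. There their images under [f] agree as well, so [W]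
    also intertwines the images. *)
Lemma mxfun_diag n (f : C -> C) (A U : 'M[C]_n) x :
  diagonalizes A U x ->
  mxfun f A = adjmx U *m diag_mx (\row_i f (rc (x i))) *m U.
Proof.
move=> dA; have AS := diagonalizes_spectral dA.
have [UU UU' AE] := dA.
rewrite /mxfun; set S := spectralmx A in AS *; set d := spectral_diag A in AS *.
have [SS SV] : S *m adjmx S = 1%:M /\ invmx S = adjmx S := spectralmx_adj A.
have Su : S \in unitmx by apply: (mulmx1_unit SS).1.
clearbody S d; clear dA.
have [W WE] : exists W, W = S *m adjmx U by exists (S *m adjmx U).
have SWU : S = W *m U by rewrite WE -mulmxA UU' mulmx1.
have DW : diag_mx d *m W = W *m diagc x.
  have E : S *m A = diag_mx d *m S by rewrite {1}AS !mulmxA (mulmxV Su) mul1mx.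
  by rewrite WE mulmxA -E AE !mulmxA -(mulmxA _ U) UU mulmx1.
have FW : diag_mx (map_mx f d) *m W = W *m diag_mx (\row_i f (rc (x i))).
  apply/matrixP=> i j; have /matrixP/(_ i j) := DW.
  rewrite !mul_diag_mx !mul_mx_diag !mxE ![_ * W i j]mulrC.
  have [->|Wn] := eqVneq (W i j) 0; first by rewrite !mul0r.
  by move=> /(mulfI Wn) ->.
have -> : adjmx U = invmx S *m W by rewrite WE mulmxA (mulVmx Su) mul1mx.
by rewrite {2}SWU -!mulmxA; congr (_ *m _); rewrite !mulmxA FW.
Qed.

(** The [i]-th eigenvalue is the squared norm of column [i] of [N *m adjmx S], which shows at once
    that it is real and nonnegative. *)
Lemma gram_diag t n (N : 'M[C]_(t, n)) :
  exists U x, diagonalizes (adjmx N *m N) U x /\ forall i, 0 <= x i.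
Proof.
set A := adjmx N *m N; set S := spectralmx A.
have [SS SV] : S *m adjmx S = 1%:M /\ invmx S = adjmx S := spectralmx_adj A.
have Su : S \in unitmx by apply: (mulmx1_unit SS).1.
have SS' : adjmx S *m S = 1%:M by rewrite -SV mulVmx.
have AS : A = invmx S *m diag_mx (spectral_diag A) *m S.
  apply/orthomx_spectralP; apply/normalmxP.
  have Ah : adjmx A = A by rewrite !adjmxM adjmxK.
  by move: Ah; rewrite /adjmx -map_trmx => ->.
set d := spectral_diag A in AS; clearbody S d.
exists S, (fun i => \sum_k nsq ((N *m adjmx S) k i)).
split; last by move=> i; apply: sumr_ge0 => k _; apply: nsq_ge0.
have E : diag_mx d = adjmx (N *m adjmx S) *m (N *m adjmx S).
  rewrite adjmxM adjmxK mulmxA -(mulmxA S) -/A AS SV.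
  by rewrite !mulmxA SS mul1mx -mulmxA SS mulmx1.
split; [exact: SS | exact: SS' |].
rewrite {1}AS SV; congr (_ *m diag_mx _ *m _); apply/rowP=> i.
have /matrixP/(_ i i) := E; rewrite [LHS]mxE eqxx mulr1n [RHS]mxE => ->.
by rewrite mxE rmorph_sum /=; apply: eq_bigr => k _; rewrite adjmxE nsq_conj.
Qed.

End ComplexMatrices.

(** * Relative entropy in terms of spectral overlaps *)

Section Overlaps.
Variable R : realType.
Local Notation C := R[i].
Local Notation rc := (real_complex R).

Definition overlap n (U T : 'M[C]_n) i j : R := nsq ((U *m adjmx T) i j).

Lemma overlap_ge0 n (U T : 'M[C]_n) i j : 0 <= overlap U T i j.
Proof. exact: nsq_ge0. Qed.

Lemma overlapC n (U T : 'M[C]_n) i j : overlap U T i j = overlap T U j i.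
Proof.
by rewrite /overlap -[T in LHS]adjmxK adjmxK -nsq_conjC -adjmxE adjmxM adjmxK.
Qed.

Lemma overlap_row_sum n (U T : 'M[C]_n) i :
  U *m adjmx U = 1%:M -> adjmx T *m T = 1%:M -> \sum_j overlap U T i j = 1.
Proof.
move=> UU TT; set X := U *m adjmx T.
have XX : X *m adjmx X = 1%:M.
  by rewrite adjmxM adjmxK mulmxA -(mulmxA U) TT mulmx1.
have /matrixP/(_ i i) := XX; rewrite !mxE eqxx mulr1n => E.
apply: rcI; rewrite rmorph_sum rmorph1 /= -E; apply: eq_bigr => j _.
by rewrite /overlap nsq_conj mulrC -/X -adjmxE.
Qed.

Lemma overlap_col_sum n (U T : 'M[C]_n) j :
  adjmx U *m U = 1%:M -> T *m adjmx T = 1%:M -> \sum_i overlap U T i j = 1.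
Proof.
by move=> UU TT; under eq_bigr do rewrite overlapC; apply: overlap_row_sum.
Qed.

Lemma tr_diag_overlap n (U T : 'M[C]_n) (a b : 'I_n -> R) :
  \tr (adjmx U *m diagc a *m U *m (adjmx T *m diagc b *m T)) =
  rc (\sum_i \sum_j overlap U T i j * (a i * b j)).
Proof.
rewrite -!mulmxA mxtrace_mulC -!mulmxA (mulmxA U) rmorph_sum /=.
set X := U *m adjmx T.
have -> : T *m adjmx U = adjmx X by rewrite adjmxM adjmxK.
apply: eq_bigr => i _; rewrite mul_diagc mxE mulr_sumr rmorph_sum /=.
apply: eq_bigr => j _; rewrite mul_diagc adjmxE !rmorphM /=.
by rewrite /overlap -/X nsq_conj; ring.
Qed.

Lemma tr_diagonalizes n (A U : 'M[C]_n) x :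
  diagonalizes A U x -> \tr A = rc (\sum_i x i).
Proof.
move=> [UU _ ->]; rewrite -mulmxA mxtrace_mulC -mulmxA UU mulmx1 mxtrace_diag.
by rewrite rmorph_sum; apply: eq_bigr => i _; rewrite mxE.
Qed.

Lemma mxlog_diag n (A U : 'M[C]_n) x :
  diagonalizes A U x -> mxlog A = adjmx U *m diagc (fun i => ln (x i)) *m U.
Proof.
move=> dA; rewrite /mxlog (mxfun_diag _ dA); congr (_ *m diag_mx _ *m _).
(* Both [clog] and [ln] vanish at nonpositive arguments. *)
apply/rowP=> i; rewrite !mxE /clog /=; case: ltP => // x0.
by rewrite ln0.
Qed.

Lemma relent_diag n (rho sigma U T : 'M[C]_n) p s :
  diagonalizes rho U p -> diagonalizes sigma T s ->
  relent rho sigma = \sum_i \sum_j overlap U T i j * (p i * (ln (p i) - ln (s j))).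
Proof.
move=> dU dT; rewrite /relent (mxlog_diag dU) (mxlog_diag dT) mulmxBr.
have [UU UU' rE] := dU; have [TT TT' _] := dT.
rewrite raddfB /= {2}rE tr_diag_overlap {1}rE.
(* This trace involves [rho] alone; the unit row sums of the overlaps spread it over [j], so that it
   combines with the mixed term. *)
have -> : \tr (adjmx U *m diagc p *m U *m (adjmx U *m diagc (fun i => ln (p i)) *m U))
    = rc (\sum_i \sum_j overlap U T i j * (p i * ln (p i))).
  rewrite -!mulmxA mxtrace_mulC -!mulmxA UU mulmx1 (mulmxA U) UU mul1mx.
  rewrite diagcM mxtrace_diag rmorph_sum /=; apply: eq_bigr => i _.
  by rewrite -mulr_suml overlap_row_sum // mul1r mxE.
rewrite -rmorphB Re_rc -sumrB; apply: eq_bigr => i _; rewrite -sumrB.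
by apply: eq_bigr => j _; rewrite mulrBr mulrBr.
Qed.

Lemma gram_fnorm2 t t' n q (N : 'M[C]_(t, n)) (N' : 'M[C]_(t', n)) (Y : 'M[C]_(n, q)) :
  adjmx N *m N = adjmx N' *m N' -> fnorm2 (N *m Y) = fnorm2 (N' *m Y).
Proof.
move=> E; apply: rcI.
by rewrite -!tr_gram !adjmxM !mulmxA -(mulmxA _ (adjmx N)) -(mulmxA _ (adjmx N')) E.
Qed.

Lemma quad_diag t n (N : 'M[C]_(t, n)) U p (y : 'cV_n) :
  diagonalizes (adjmx N *m N) U p ->
  fnorm2 (N *m y) = \sum_i p i * nsq ((U *m y) i 0).
Proof.
move=> [_ _ E]; apply: rcI; rewrite -tr_gram adjmxM mulmxA -(mulmxA (adjmx y)) E.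
have -> : adjmx y *m (adjmx U *m diagc p *m U) *m y
    = adjmx (U *m y) *m (diagc p *m (U *m y)) by rewrite adjmxM !mulmxA.
rewrite /mxtrace big_ord1 mxE rmorph_sum /=; apply: eq_bigr => i _.
by rewrite mul_diagc adjmxE rmorphM /= nsq_conj; ring.
Qed.

(** * Polar decomposition *)

Section Polar.
Variables (t n : nat) (N : 'M[C]_(t, n)) (U : 'M[C]_n) (p : 'I_n -> R).
Hypothesis dN : diagonalizes (adjmx N *m N) U p.
Hypothesis p0 : forall i, 0 <= p i.

(* With the polar decomposition [N = W sqrt(N^* N)], this is [U W^*]. *)
Definition polar : 'M[C]_(n, t) :=
  diagc (fun i => (Num.sqrt (p i))^-1) *m (U *m adjmx N).

(** Where [p i = 0] the inverse in [polar] is 0, but row [i] of [U *m adjmx N] has squared norm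
    [p i] and vanishes too. *)
Lemma polarE : U *m adjmx N = diagc (fun i => Num.sqrt (p i)) *m polar.
Proof.
have [UU _ E] := dN.
apply/matrixP=> i k; rewrite /polar mul_diagc mul_diagc mulrA -rmorphM /=.
have [pi0|pn] := eqVneq (p i) 0; last first.
  by rewrite divff ?rmorph1 ?mul1r // gt_eqF // sqrtr_gt0 lt_neqAle eq_sym pn p0.
rewrite pi0 sqrtr0 mul0r rmorph0 mul0r; apply/eqP; rewrite -nsq_eq0.
have G : U *m adjmx N *m adjmx (U *m adjmx N) = diagc p.
  rewrite adjmxM adjmxK mulmxA -(mulmxA U) E !mulmxA UU mul1mx.
  by rewrite -mulmxA UU mulmx1.
have /matrixP/(_ i i) := G; rewrite !mxE eqxx mulr1n pi0 => S0.
have S1 : \sum_k nsq ((U *m adjmx N) i k) = 0.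
  apply: rcI; rewrite -S0 rmorph_sum; apply: eq_bigr => l _ /=.
  by rewrite [adjmx (U *m _) _ _]adjmxE nsq_conj mulrC.
have S2 := psumr_eq0P (fun l _ => nsq_ge0 _) S1.
by apply/eqP; rewrite -(S2 k isT) mxE.
Qed.

Lemma polar_gram : polar *m N = diagc (fun i => Num.sqrt (p i)) *m U.
Proof.
have [UU _ E] := dN.
rewrite /polar -!mulmxA E !mulmxA -(mulmxA _ U) UU mulmx1 diagcM.
congr (_ *m _); apply: eq_diagc => i.
rewrite -{2}[p i]sqr_sqrtr // expr2 mulrA.
have [->|sn] := eqVneq (Num.sqrt (p i)) 0; first by rewrite mulr0.
by rewrite mulVf // mul1r.
Qed.

(** [polar *m adjmx polar] is diagonal with entries 0 and 1 and fixes [polar], so [polar] is a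
    partial isometry. *)
Lemma polar_proj : adjmx polar *m polar *m (adjmx polar *m polar) = adjmx polar *m polar.
Proof.
set r := fun i => (Num.sqrt (p i))^-1; set q := fun i => Num.sqrt (p i).
have QQ : polar *m adjmx polar = diagc (fun i => q i * r i).
  rewrite {2}/polar adjmxM adjmxM adjmxK adjmx_diagc mulmxA mulmxA polar_gram.
  have [UU _ _] := dN.
  by rewrite -!mulmxA (mulmxA U) UU mul1mx diagcM.
have PQ : diagc (fun i => q i * r i) *m polar = polar.
  rewrite /polar mulmxA diagcM; congr (_ *m _); apply: eq_diagc => i.
  rewrite -/r /r /q; have [->|sn] := eqVneq (Num.sqrt (p i)) 0.
    by rewrite mul0r mul0r invr0.
  by rewrite divff // mul1r.
by rewrite mulmxA -(mulmxA _ polar) QQ -mulmxA PQ.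
Qed.

Lemma fnorm2_polar_le q (Y : 'M[C]_(t, q)) : fnorm2 (polar *m Y) <= fnorm2 Y.
Proof.
have Th : adjmx (adjmx polar *m polar) = adjmx polar *m polar.
  by rewrite adjmxM adjmxK.
apply: le_trans (fnorm2_proj_le Y Th polar_proj).
rewrite le_eqVlt; apply/orP; left; apply/eqP; apply: gram_fnorm2.
by rewrite Th polar_proj.
Qed.

End Polar.

(** The left side is the squared Frobenius distance between the absolute values of [N] and [L]:
    taking absolute values is Lipschitz with constant 2. *)
Lemma sqrt_overlap_le t n (N L : 'M[C]_(t, n)) U T p s :
  diagonalizes (adjmx N *m N) U p -> (forall i, 0 <= p i) ->
  diagonalizes (adjmx L *m L) T s -> (forall i, 0 <= s i) ->
  \sum_i \sum_j overlap U T i j * (Num.sqrt (p i) - Num.sqrt (s j)) ^+ 2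
    <= 4 * fnorm2 (N - L).
Proof.
move=> dU p0 dT s0; have [UU UU' NE] := dU; have [TT TT' LE] := dT.
set D := N - L; set X := U *m adjmx T.
(* [N^* N - L^* L = N^* D + D^* L]; entrywise this reads [(p_i - s_j) X_ij =
   sqrt p_i Y_ij + sqrt s_j Z_ij], and [Y], [Z] have norm at most that of [D]. *)
set Y := polar N U p *m (D *m adjmx T).
set Z := U *m adjmx (polar L T s *m D).
have E : diagc p *m X - X *m diagc s
  = diagc (fun i => Num.sqrt (p i)) *m Y + Z *m diagc (fun i => Num.sqrt (s i)).
  have -> : diagc p *m X = U *m (adjmx N *m N) *m adjmx T.
    by rewrite NE /X !mulmxA UU mul1mx.
  have -> : X *m diagc s = U *m (adjmx L *m L) *m adjmx T.
    by rewrite LE /X -!mulmxA TT mulmx1.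
  have -> : Z *m diagc (fun i => Num.sqrt (s i)) = U *m adjmx D *m L *m adjmx T.
    rewrite /Z adjmxM -!mulmxA -[diagc (fun i => Num.sqrt (s i))]adjmx_diagc.
    by rewrite -adjmxM -(polarE dT s0) adjmxM adjmxK.
  rewrite /Y (mulmxA (diagc _)) -(polarE dU p0) /D adjmxB.
  rewrite !mulmxBl !mulmxBr !mulmxBl !mulmxA.
  by rewrite addrA subrK.
have B i j : overlap U T i j * (Num.sqrt (p i) - Num.sqrt (s j)) ^+ 2
    <= 2 * nsq (Y i j) + 2 * nsq (Z i j).
  have /matrixP/(_ i j) := E.
  rewrite [LHS]mxE [X in _ + X = _]mxE [RHS]mxE !mul_diagc !mul_mx_diagc.
  rewrite /overlap -/X; set a := Num.sqrt (p i); set b := Num.sqrt (s j).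
  set x := X i j; set y := Y i j; set z := Z i j => Eij.
  have a0 : 0 <= a by apply: sqrtr_ge0.
  have b0 : 0 <= b by apply: sqrtr_ge0.
  have pE : p i = a ^+ 2 by rewrite sqr_sqrtr.
  have sE : s j = b ^+ 2 by rewrite sqr_sqrtr.
  have [ab0|abn] := eqVneq (a + b) 0.
    have -> : a - b = 0 by move: ab0 a0 b0; lra.
    by rewrite expr0n mulr0 addr_ge0 // mulr_ge0 // nsq_ge0.
  (* Multiplication by [(a + b)^2] turns [a - b] into [p i - s j], to which the identity [E]
     applies. *)
  have ab2 : 0 < (a + b) ^+ 2 by rewrite exprn_even_gt0.
  rewrite -(ler_pM2l ab2).
  have -> : (a + b) ^+ 2 * (nsq x * (a - b) ^+ 2) = nsq (rc a * y + z * rc b).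
    rewrite -Eij pE sE -[in rc _ * x](mulrC x) -mulrBr -rmorphB nsqM nsq_rc.
    by ring.
  apply: le_trans (nsqD_le _ _) _; rewrite !nsqM !nsq_rc.
  have : 0 <= nsq y by apply: nsq_ge0.
  have : 0 <= nsq z by apply: nsq_ge0.
  move: (nsq y) (nsq z) => v w w0 v0.
  have := mulr_ge0 (mulr_ge0 a0 b0) v0; have := mulr_ge0 (mulr_ge0 a0 b0) w0.
  have := mulr_ge0 (mulr_ge0 a0 a0) w0; have := mulr_ge0 (mulr_ge0 b0 b0) v0.
  rewrite !expr2; lra.
apply: le_trans (ler_sum _ (fun i _ => ler_sum _ (fun j _ => B i j))) _.
have -> : \sum_i \sum_j (2 * nsq (Y i j) + 2 * nsq (Z i j)) = 2 * fnorm2 Y + 2 * fnorm2 Z.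
  rewrite /fnorm2 !mulr_sumr -big_split; apply: eq_bigr => i _ /=.
  by rewrite !mulr_sumr -big_split.
have YD : fnorm2 Y <= fnorm2 D.
  apply: le_trans (fnorm2_polar_le dU p0 _) _.
  by rewrite -fnorm2_adj adjmxM adjmxK fnorm2_isometry // fnorm2_adj.
have ZD : fnorm2 Z <= fnorm2 D.
  by rewrite fnorm2_isometry // fnorm2_adj; apply: (fnorm2_polar_le dT s0 D).
move: YD ZD; lra.
Qed.

(** * Consequences of the operator inequality between two Gram matrices *)

Section Domination.
Variables (t t' n : nat) (N : 'M[C]_(t, n)) (L : 'M[C]_(t', n)).
Variables (U T : 'M[C]_n) (p s : 'I_n -> R) (w : R).
Hypothesis dU : diagonalizes (adjmx N *m N) U p.
Hypothesis dT : diagonalizes (adjmx L *m L) T s.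
Hypothesis p0 : forall i, 0 <= p i.
Hypothesis NL : forall y : 'cV[C]_n, fnorm2 (N *m y) <= w * fnorm2 (L *m y).

(** The eigenvector of [adjmx L *m L] for [s j = 0] is killed by [L], hence by [N]. *)
Lemma overlap_kernel i j : s j = 0 -> overlap U T i j * p i = 0.
Proof.
move=> sj0; have [UU UU' NE] := dU; have [TT TT' LE] := dT.
have colM (A B : 'M[C]_n) : A *m col j B = col j (A *m B).
  by rewrite !colE mulmxA.
have := NL (col j (adjmx T)); rewrite (quad_diag _ dU) (quad_diag _ dT).
rewrite [X in _ <= _ * X]big1 => [|k _]; last first.
  rewrite colM TT 2!mxE; case: eqP => [->|_]; first by rewrite sj0 mul0r.
  by rewrite nsq0 mulr0.
rewrite mulr0 => le0; rewrite mulrC.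
have ge0 k : true -> 0 <= p k * nsq ((U *m col j (adjmx T)) k 0).
  by move=> _; rewrite mulr_ge0 // nsq_ge0.
have /psumr_eq0P S0 : \sum_k p k * nsq ((U *m col j (adjmx T)) k 0) = 0.
  by apply/eqP; rewrite eq_le le0 sumr_ge0.
by rewrite -(S0 ge0 i isT) colM mxE.
Qed.

(** Test the domination on the pseudo-inverse of [adjmx L *m L] applied to the [i]-th eigenvector of
    [adjmx N *m N]. With [b] the sum of [overlap U T i j / s j], this gives
    [p i * b ^+ 2 <= w * b]. *)
Lemma overlap_ratio_le i :
  0 <= w -> (forall j, 0 <= s j) -> \sum_j overlap U T i j * p i / s j <= w.
Proof.
move=> w0 s0; have [UU UU' NE] := dU; have [TT TT' LE] := dT.
set X := U *m adjmx T; set b := \sum_j overlap U T i j / s j.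
have -> : \sum_j overlap U T i j * p i / s j = p i * b.
  by rewrite mulr_sumr; apply: eq_bigr => j _; rewrite mulrAC mulrC.
have b0 : 0 <= b.
  by apply: sumr_ge0 => j _; rewrite divr_ge0 // nsq_ge0.
pose z : 'cV[C]_n := \col_j (rc (s j)^-1 * (X i j)^*).
have := NL (adjmx T *m z); rewrite (quad_diag _ dU) (quad_diag _ dT).
rewrite !mulmxA TT mul1mx -/X => le.
have Eb : (X *m z) i 0 = rc b.
  rewrite mxE rmorph_sum /=; apply: eq_bigr => j _.
  by rewrite [z _ _]mxE /overlap -/X rmorphM /= nsq_conj; ring.
have Ez : \sum_j s j * nsq (z j 0) = b.
  apply: eq_bigr => j _; rewrite [z _ _]mxE nsqM nsq_rc nsq_conjC /overlap -/X.
  have [->|sn] := eqVneq (s j) 0; first by rewrite invr0 mul0r mulr0.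
  by field.
have le2 : p i * b ^+ 2 <= w * b.
  rewrite -[in leRHS]Ez; apply: le_trans le.
  rewrite (bigD1 i) //= Eb nsq_rc lerDl sumr_ge0 // => k _.
  by rewrite mulr_ge0 // nsq_ge0.
have [->|bn] := eqVneq b 0; first by rewrite mulr0.
have bp : 0 < b by rewrite lt_neqAle eq_sym bn.
by rewrite -(ler_pM2r bp) -mulrA -expr2.
Qed.

End Domination.

(** * Lower and upper bounds on the relative entropy *)

Section Relent.
Variables (t t' n : nat) (N : 'M[C]_(t, n)) (L : 'M[C]_(t', n)).
Variables (U T : 'M[C]_n) (p s : 'I_n -> R) (w : R).
Hypothesis dU : diagonalizes (adjmx N *m N) U p.
Hypothesis dT : diagonalizes (adjmx L *m L) T s.
Hypothesis p0 : forall i, 0 <= p i.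
Hypothesis s0 : forall i, 0 <= s i.
Hypothesis w0 : 0 <= w.
Hypothesis NL : forall y : 'cV[C]_n, fnorm2 (N *m y) <= w * fnorm2 (L *m y).
Hypothesis trN : \sum_i p i = 1.

Let rowU i : \sum_j overlap U T i j = 1.
Proof. by have [? _ _] := dU; have [_ ? _] := dT; apply: overlap_row_sum. Qed.

Let sum_cp : \sum_i \sum_j overlap U T i j * p i = 1.
Proof.
by rewrite -trN; apply: eq_bigr => i _; rewrite -mulr_suml rowU mul1r.
Qed.

Lemma relent_affinity :
  2 * (1 - \sum_i \sum_j overlap U T i j * (Num.sqrt (p i) * Num.sqrt (s j)))
    <= relent (adjmx N *m N) (adjmx L *m L).
Proof.
rewrite (relent_diag dU dT) -[X in _ * (X - _)]sum_cp -sumrB mulr_sumr.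
apply: ler_sum => i _; rewrite -sumrB mulr_sumr; apply: ler_sum => j _.
apply: relent_term_ge => //; first exact: overlap_ge0.
exact: overlap_kernel dU dT p0 NL _ _.
Qed.

(** The arithmetic-geometric mean inequality, summed against doubly stochastic weights. *)
Lemma affinity_le1 : \sum_i s i = 1 ->
  \sum_i \sum_j overlap U T i j * (Num.sqrt (p i) * Num.sqrt (s j)) <= 1.
Proof.
move=> trL.
have E : \sum_i \sum_j overlap U T i j * (p i / 2 + s j / 2) = 1.
  under eq_bigr do under eq_bigr do rewrite mulrDr !mulrA.
  under eq_bigr do rewrite big_split /=.
  rewrite big_split /= (exchange_big _ _ _ _ _ (fun i j => overlap U T i j * s j / 2)) /=.
  under eq_bigr do rewrite -mulr_suml.
  rewrite -mulr_suml sum_cp.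
  under eq_bigr do rewrite -2!mulr_suml.
  have [UU UU' _] := dU; have [TT TT' _] := dT.
  under eq_bigr do rewrite overlap_col_sum // mul1r.
  by rewrite -mulr_suml trL; lra.
rewrite -[leRHS]E; apply: ler_sum => i _; apply: ler_sum => j _.
apply: ler_wpM2l; first exact: overlap_ge0.
have := sqr_ge0 (Num.sqrt (p i) - Num.sqrt (s j)).
rewrite sqrrB !sqr_sqrtr // mulr2n; lra.
Qed.

Lemma relent_close (eta D : R) : 0 < eta -> eta <= 1 -> 1 <= w ->
  \sum_i \sum_j overlap U T i j * (Num.sqrt (p i) - Num.sqrt (s j)) ^+ 2 <= D ->
  relent (adjmx N *m N) (adjmx L *m L) <= 3 * eta + D * (6 / eta + 4 * ln w).
Proof.
(* With this [u] the last term of [relent_term_le] sums to at most [w / u = eta], while [ln u] costs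
   only [ln w + 1 / eta]. *)
move=> e0 e1 w1 leD; set u := w / eta.
have wp : 0 < w by apply: lt_le_trans w1.
have u1 : 1 <= u by rewrite ler_pdivlMr // mul1r (le_trans e1).
have lu : ln u <= ln w + eta^-1.
  rewrite lnM ?posrE ?invr_gt0 // lerD2l.
  have : ln eta^-1 <= eta^-1 - 1 by apply: ln_le_subr1; rewrite invr_gt0.
  lra.
have step : relent (adjmx N *m N) (adjmx L *m L) <=
    2 * eta + (2 / eta + 4 * ln u) * D + u^-1 * w.
  rewrite (relent_diag dU dT).
  apply: (@le_trans _ _ (2 * eta * (\sum_i \sum_j overlap U T i j * p i)
    + (2 / eta + 4 * ln u) * (\sum_i \sum_j
         overlap U T i j * (Num.sqrt (p i) - Num.sqrt (s j)) ^+ 2)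
    + u^-1 * (\sum_i \sum_j p i * (overlap U T i j * p i / s j)))).
    rewrite !mulr_sumr -!big_split; apply: ler_sum => i _ /=.
    rewrite !mulr_sumr -!big_split; apply: ler_sum => j _ /=.
    apply: relent_term_le => //; first exact: overlap_ge0.
    exact: overlap_kernel dU dT p0 NL _ _.
  rewrite sum_cp mulr1; apply: lerD; last first.
    rewrite ler_wpM2l ?invr_ge0 ?(le_trans ler01) //.
    rewrite -[leRHS]mul1r -[X in _ <= X * _]trN mulr_suml; apply: ler_sum => i _.
    rewrite -mulr_sumr ler_wpM2l //.
    exact: overlap_ratio_le dU dT p0 NL _ w0 s0.
  rewrite lerD2l ler_wpM2l //.
    by rewrite addr_ge0 ?mulr_ge0 ?ln_ge0 // invr_ge0 ltW.
apply: le_trans step _.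
have -> : u^-1 * w = eta by rewrite /u; field; rewrite !gt_eqF.
have F0 : 0 <= D.
  apply: le_trans leD; do 2![apply: sumr_ge0 => ? _].
  by rewrite mulr_ge0 ?sqr_ge0 // nsq_ge0.
rewrite [leRHS](_ : _ = 2 * eta + (6 / eta + 4 * ln w) * D + eta); last by ring.
rewrite lerD2r lerD2l ler_wpM2r //; move: lu; move: (ln u) (ln w) (eta^-1) => a b c; lra.
Qed.

End Relent.

End Overlaps.

(** * Codes and recoveries *)

Section Kronecker.
Variables (R : realType) (K : nat).
Local Notation C := R[i].
Local Notation rc := (real_complex R).

Lemma pidxK m (k : 'I_(m * K)) : mxvec_index (pidx k).1 (pidx k).2 = k.
Proof. by rewrite /pidx; case: (mxvec_indexP k). Qed.

Lemma mxvec_indexK m (u : 'I_m) (q : 'I_K) : pidx (mxvec_index u q) = (u, q).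
Proof.
have [g gK _] := curry_mxvec_bij m K.
have : uncurry (@mxvec_index m K) (pidx (mxvec_index u q))
       = uncurry (@mxvec_index m K) (u, q).
  by rewrite /= -[RHS](pidxK (mxvec_index u q)); case: (pidx _).
by move/(congr1 g); rewrite !gK.
Qed.

(** Also used from right to left, to merge iterated sums into one sum over a paired index. *)
Lemma sum_pidx (M : nmodType) m (F : 'I_m -> 'I_K -> M) :
  \sum_(k < m * K) F (pidx k).1 (pidx k).2 = \sum_u \sum_q F u q.
Proof.
rewrite pair_bigA /= (reindex (uncurry (@mxvec_index m K))) /=; last first.
  by have := curry_mxvec_bij m K.
by apply: eq_bigr => [[u q]] _ /=; rewrite mxvec_indexK.
Qed.

(* [A] tensored with the identity of size [K], in the index convention of [Lambda_mx]. *)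
Definition kron r m (A : 'M[C]_(r, m)) : 'M[C]_(r * K, m * K) :=
  \matrix_(k, l) (A (pidx k).1 (pidx l).1 * ((pidx k).2 == (pidx l).2)%:R).

Lemma kronM r m n (A : 'M[C]_(r, m)) (B : 'M[C]_(m, n)) :
  kron A *m kron B = kron (A *m B).
Proof.
apply/matrixP=> k l; rewrite !mxE.
under eq_bigr do rewrite !mxE.
rewrite (sum_pidx (fun u q => A (pidx k).1 u * ((pidx k).2 == q)%:R
   * (B u (pidx l).1 * (q == (pidx l).2)%:R))) mulr_suml.
apply: eq_bigr => u _; rewrite (bigD1 (pidx k).2) //= eqxx mulr1 mulrA.
by rewrite big1 ?addr0 // => q /negPf qn; rewrite eq_sym qn mulr0 mul0r.
Qed.

Lemma kron_adj r m (A : 'M[C]_(r, m)) : adjmx (kron A) = kron (adjmx A).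
Proof.
by apply/matrixP=> k l; rewrite !mxE rmorphM /= rmorph_nat eq_sym.
Qed.

Lemma kron_diagc m (x : 'I_m -> R) : kron (diagc x) = diagc (fun k => x (pidx k).1).
Proof.
apply/matrixP=> k l; rewrite !mxE.
have [->|kl] := eqVneq k l; first by rewrite !eqxx mulr1.
have [e1|] := eqVneq (pidx k).1 (pidx l).1; last by rewrite !mulr0n mul0r.
have [e2|] := eqVneq (pidx k).2 (pidx l).2; last by rewrite mulr0n mulr0.
by case/eqP: kl; rewrite -(pidxK k) -(pidxK l) e1 e2.
Qed.

Lemma kron1 m : kron 1%:M = 1%:M :> 'M[C]_(m * K).
Proof.
have E n : 1%:M = diagc (fun _ : 'I_n => 1).
  by apply/matrixP=> i j; rewrite !mxE rmorph1.
by rewrite E kron_diagc -E.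
Qed.

Lemma kronD r m (A B : 'M[C]_(r, m)) : kron (A + B) = kron A + kron B.
Proof. by apply/matrixP=> k l; rewrite !mxE mulrDl. Qed.

Lemma fnorm2_kron r m (A : 'M[C]_(r, m)) : fnorm2 (kron A) = K%:R * fnorm2 A.
Proof.
rewrite /fnorm2.
under eq_bigr do under eq_bigr do rewrite mxE.
rewrite (sum_pidx (fun i q => \sum_l nsq (A i (pidx l).1 * (q == (pidx l).2)%:R))).
rewrite mulr_sumr; apply: eq_bigr => i _.
under eq_bigr => q _.
  rewrite (sum_pidx (fun u q' => nsq (A i u * (q == q')%:R))).
  rewrite (_ : \sum_u _ = \sum_u nsq (A i u)); last first.
    apply: eq_bigr => u _; rewrite (bigD1 q) //= eqxx mulr1 big1 ?addr0 // => q'.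
    by rewrite eq_sym => /negPf ->; rewrite mulr0 nsq0.
  over.
by rewrite sumr_const card_ord mulr_natl.
Qed.

Lemma diagonalizes_kron m (A U : 'M[C]_m) x (a : R) :
  diagonalizes A U x ->
  diagonalizes (rc a *: kron A) (kron U) (fun k => a * x (pidx k).1).
Proof.
move=> [UU UU' ->]; split; first by rewrite kron_adj kronM UU kron1.
  by rewrite kron_adj kronM UU' kron1.
rewrite -!kronM kron_diagc kron_adj scalemxAl scalemxAr; congr (_ *m _ *m _).
by apply/matrixP=> k l; rewrite !mxE mulrnAr -rmorphM.
Qed.

End Kronecker.

(** * Factorizations attached to one code *)

Section SingleCode.
Variable R : realType.
Local Notation C := R[i].
Local Notation rc := (real_complex R).
Variables (d K m : nat) (V : 'M[C]_(d, K)) (E : 'I_m -> 'M[C]_d).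
Hypothesis K_gt0 : (0 < K)%N.
Hypothesis isoV : is_isometry V.
Hypothesis tpE : kraus_tp E.

Local Notation kap := (Num.sqrt (K%:R : R))^-1.

Let K0 : K%:R != 0 :> R. Proof. by rewrite pnatr_eq0 -lt0n. Qed.

Lemma kap_sq : kap ^+ 2 * K%:R = 1.
Proof. by rewrite exprVn sqr_sqrtr ?ler0n // mulVf. Qed.

Lemma rc_kap_sq : rc kap * rc kap = K%:R^-1.
Proof.
have KC : K%:R != 0 :> C by rewrite pnatr_eq0 -lt0n.
apply: (mulIf KC); rewrite mulVf // -(rmorph_nat (real_complex R)) -!rmorphM.
by rewrite -expr2 kap_sq rmorph1.
Qed.

Definition noise_mx : 'M[C]_(d, m * K) :=
  \matrix_(a, k) (rc kap * (E (pidx k).1 *m V) a (pidx k).2).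

(** The entries of [noise_mx] reshaped: the code index joins the rows and only the environment index
    labels columns, so the Gram matrix is the partial trace [lambda]. *)
Definition env_mx : 'M[C]_(d * K, m) :=
  \matrix_(b, u) (rc kap * (E u *m V) (pidx b).1 (pidx b).2).

Definition env_kron : 'M[C]_(d * K * K, m * K) := rc kap *: kron K env_mx.

Lemma tr_mul_adj p q (A B : 'M[C]_(p, q)) :
  \tr (adjmx A *m B) = \sum_a \sum_b (A a b)^* * B a b.
Proof.
rewrite exchange_big; apply: eq_bigr => b _; rewrite mxE.
by apply: eq_bigr => a _; rewrite adjmxE.
Qed.

Lemma lambda_uvE u v :
  lambda_uv V E u v = \tr (adjmx (E u *m V) *m (E v *m V)) / K%:R.
Proof.
rewrite /lambda_uv /code_proj; congr (_ / _).
rewrite -!mulmxA mxtrace_mulC -!mulmxA isoV mulmx1.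
by rewrite adjmxM !mulmxA.
Qed.

Lemma env_gram u v : (adjmx env_mx *m env_mx) u v = lambda_uv V E u v.
Proof.
rewrite lambda_uvE tr_mul_adj mxE.
transitivity (\sum_b ((E u *m V) (pidx b).1 (pidx b).2)^*
   * (E v *m V) (pidx b).1 (pidx b).2 / (K%:R : C)).
  apply: eq_bigr => b _; rewrite adjmxE 2![env_mx _ _]mxE rmorphM /= conj_rc.
  by rewrite -rc_kap_sq; ring.
rewrite (sum_pidx (fun a q => ((E u *m V) a q)^* * (E v *m V) a q / K%:R)).
by rewrite mulr_suml; apply: eq_bigr => a _; rewrite mulr_suml.
Qed.

(** The multiple of the projector subtracted in [B_uv] is restored by [Lambda_mx]. *)
Lemma noise_gram : adjmx noise_mx *m noise_mx = Lambda_mx V E + B_mx V E.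
Proof.
apply/matrixP=> k l; rewrite [RHS]mxE [Lambda_mx _ _ _ _]mxE [B_mx _ _ _ _]mxE.
set u := (pidx k).1; set v := (pidx l).1; set q1 := (pidx k).2; set q2 := (pidx l).2.
have -> : adjmx V *m B_uv V E u v *m V
    = adjmx (E u *m V) *m (E v *m V) - lambda_uv V E u v *: 1%:M.
  rewrite /B_uv /code_proj mulmxBr mulmxBl -scalemxAr -scalemxAl.
  rewrite !mulmxA isoV mul1mx isoV -!mulmxA isoV !mulmx1 adjmxM.
  by rewrite !mulmxA.
have -> : (adjmx (E u *m V) *m (E v *m V) - lambda_uv V E u v *: 1%:M) q1 q2
    = (adjmx (E u *m V) *m (E v *m V)) q1 q2 - lambda_uv V E u v * (q1 == q2)%:R.
  by rewrite [LHS]mxE [X in _ + X = _]mxE [X in _ - X = _]mxE [1%:M _ _]mxE.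
rewrite mulrBl addrC subrK mxE [X in _ = X / _]mxE mulr_suml.
apply: eq_bigr => a _; rewrite !adjmxE 2![noise_mx _ _]mxE rmorphM /= conj_rc.
by rewrite -rc_kap_sq; ring.
Qed.

Lemma env_kron_gram : adjmx env_kron *m env_kron = Lambda_mx V E.
Proof.
rewrite /env_kron adjmxZ -scalemxAl -scalemxAr scalerA conj_rc rc_kap_sq.
rewrite kron_adj kronM; apply/matrixP=> k l; rewrite 2!mxE env_gram mxE.
by rewrite mulrC.
Qed.

Lemma env_norm : fnorm2 env_mx = 1.
Proof.
apply: rcI; rewrite -tr_gram rmorph1 /mxtrace.
under eq_bigr do rewrite env_gram lambda_uvE adjmxM mulmxA -(mulmxA (adjmx V)).
rewrite -mulr_suml -[\sum_i \tr _]raddf_sum -mulmx_suml -mulmx_sumr tpE.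
by rewrite mulmx1 isoV /= mxtrace1 divff // pnatr_eq0 -lt0n.
Qed.

Lemma env_kron_norm : fnorm2 env_kron = 1.
Proof. by rewrite fnorm2_Z fnorm2_kron env_norm nsq_rc mulr1 kap_sq. Qed.

(** Cauchy-Schwarz, from the nonnegativity of the variance of [F]. *)
Lemma nsq_sum_le (I : finType) (F : I -> C) :
  nsq (\sum_i F i) <= #|I|%:R * \sum_i nsq (F i).
Proof.
have [I0|In] := eqVneq #|I| 0%N.
  rewrite !big1 ?nsq0 ?mulr0 // => i _; first by have := fintype0 i I0.
  by have := fintype0 i I0.
set S := \sum_i F i; set k : R := #|I|%:R.
have kn : k != 0 by rewrite pnatr_eq0.
have k0 : 0 < k by rewrite lt_neqAle eq_sym kn ler0n.
have : 0 <= \sum_i nsq (F i - rc k^-1 * S) by apply: sumr_ge0 => i _; apply: nsq_ge0.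
under eq_bigr do rewrite nsqB.
rewrite sumrB big_split /= sumr_const -mulr_sumr -Re_sum -mulr_suml -/S.
rewrite nsqM nsq_rc rmorphM /= conj_rc mulrCA -nsq_conjr -rmorphM Re_rc.
rewrite -[_ *+ _]mulr_natl -/k.
rewrite (_ : _ - _ = \sum_i nsq (F i) - k^-1 * nsq S); last by field.
by rewrite subr_ge0 mulrC ler_pdivrMr // mulrC.
Qed.

Lemma noise_norm : fnorm2 noise_mx = 1.
Proof.
rewrite -env_norm /fnorm2.
transitivity (\sum_a \sum_q \sum_u nsq (rc kap * (E u *m V) a q)).
  apply: eq_bigr => a _; under eq_bigr do rewrite mxE.
  by rewrite (sum_pidx (fun u q => nsq (rc kap * (E u *m V) a q))) exchange_big.
rewrite -(sum_pidx (fun a q => \sum_u nsq (rc kap * (E u *m V) a q))).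
by apply: eq_bigr => b _; apply: eq_bigr => u _; rewrite [env_mx _ _]mxE.
Qed.

(** Both sides are built from the amplitudes [z a q q']: the left sums the diagonal ones inside the
    modulus, the right sums all squared moduli divided by [K]. One factor [K] comes from
    Cauchy-Schwarz, the other from this normalization. *)
Lemma noise_le_env (y : 'cV[C]_(m * K)) :
  fnorm2 (noise_mx *m y) <= K%:R ^+ 2 * fnorm2 (env_kron *m y).
Proof.
pose z a q q' := \sum_u rc kap * (E u *m V) a q * y (mxvec_index u q') 0.
have -> : fnorm2 (noise_mx *m y) = \sum_a nsq (\sum_q z a q q).
  rewrite fnorm2_colE; apply: eq_bigr => a _; congr nsq; rewrite mxE exchange_big.
  rewrite -(sum_pidx (fun u q => rc kap * (E u *m V) a q * y (mxvec_index u q) 0)).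
  by apply: eq_bigr => k _; rewrite pidxK mxE.
have -> : fnorm2 (env_kron *m y) = K%:R^-1 * \sum_a \sum_q \sum_q' nsq (z a q q').
  rewrite -scalemxAl fnorm2_Z nsq_rc -(mulfK K0 (kap ^+ 2)) kap_sq mul1r.
  congr (_ * _); rewrite fnorm2_colE -(sum_pidx (fun a q => \sum_q' nsq (z a q q'))).
  rewrite -(sum_pidx (fun b q' => nsq (z (pidx b).1 (pidx b).2 q'))).
  apply: eq_bigr => b _; congr nsq; rewrite mxE.
  set b1 := (pidx b).1; set q := (pidx b).2.
  under eq_bigr do rewrite mxE -[X in y X _]pidxK.
  rewrite (sum_pidx (fun u q' => env_mx b1 u * (q == q')%:R * y (mxvec_index u q') 0)).
  apply: eq_bigr => u _; rewrite (bigD1 q) //= eqxx mulr1 big1 ?addr0; last first.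
    by move=> q' /negPf qn; rewrite eq_sym qn mulr0 mul0r.
  by rewrite mxE.
rewrite expr2 -mulrA mulVKf // mulr_sumr; apply: ler_sum => a _.
apply: (@le_trans _ _ (K%:R * \sum_q nsq (z a q q))).
  rewrite -[K in K%:R]card_ord; exact: nsq_sum_le.
rewrite ler_wpM2l // ?ler0n //; apply: ler_sum => q _.
by rewrite (bigD1 q) //= lerDl sumr_ge0 // => q' _; apply: nsq_ge0.
Qed.

(** * Upper bound on the entropy from a given recovery *)

Section Recovery.
Variables (r : nat) (Rc : 'I_r -> 'M[C]_(K, d)).
Hypothesis tpR : kraus_tp Rc.

(** The Stinespring isometry of the recovery. *)
Definition stack_mx : 'M[C]_(r * K, d) :=
  \matrix_(b, a) Rc (pidx b).1 (pidx b).2 a.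

Lemma stack_gram : adjmx stack_mx *m stack_mx = 1%:M.
Proof.
rewrite -tpR; apply/matrixP=> a a'; rewrite mxE summxE.
under [RHS]eq_bigr do rewrite mxE.
rewrite -(sum_pidx (fun i q => adjmx (Rc i) a q * Rc i q a')).
by apply: eq_bigr => b _; rewrite !mxE.
Qed.

Definition avg_mx : 'M[C]_(r, m) :=
  \matrix_(i, u) (\tr (Rc i *m E u *m V) / K%:R).

Definition dev i u : 'M[C]_K := Rc i *m E u *m V - avg_mx i u *: 1%:M.

Definition dev_mx : 'M[C]_(r * K * K, m) :=
  \matrix_(b, u) (rc kap * dev (pidx (pidx b).1).1 u (pidx (pidx b).1).2 (pidx b).2).

Lemma ent_fidE : ent_fid V E Rc = fnorm2 avg_mx.
Proof.
apply: eq_bigr => i _; apply: eq_bigr => u _.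
by rewrite -nsqE Re_rc mxE.
Qed.

(** Each [dev i u] is traceless, hence orthogonal to the identity in the trace inner product; trace
    preservation removes the recovery from the total. *)
Lemma dev_gram : adjmx dev_mx *m dev_mx = adjmx env_mx *m env_mx - adjmx avg_mx *m avg_mx.
Proof.
have KC : K%:R != 0 :> C by rewrite pnatr_eq0 -lt0n.
apply/matrixP=> u v; rewrite [RHS]mxE env_gram lambda_uvE.
rewrite [X in _ = _ + X]mxE.
transitivity (\sum_i \tr (adjmx (dev i u) *m dev i v) / K%:R).
  under [RHS]eq_bigr do rewrite tr_mul_adj mulr_suml.
  rewrite -(sum_pidx (fun i q => (\sum_q' (dev i u q q')^* * dev i v q q') / K%:R)).
  under [RHS]eq_bigr do rewrite mulr_suml.
  rewrite -(sum_pidx (fun b q' =>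
    (dev (pidx b).1 u (pidx b).2 q')^* * dev (pidx b).1 v (pidx b).2 q' / K%:R)).
  rewrite mxE; apply: eq_bigr => b _.
  rewrite adjmxE 2![dev_mx _ _]mxE rmorphM /= conj_rc -rc_kap_sq; ring.
have -> : \tr (adjmx (E u *m V) *m (E v *m V))
    = \sum_i \tr (adjmx (Rc i *m E u *m V) *m (Rc i *m E v *m V)).
  rewrite -raddf_sum; congr (\tr _).
  under eq_bigr do rewrite -!mulmxA adjmxM -mulmxA (mulmxA (adjmx (Rc _))).
  by rewrite -mulmx_sumr -mulmx_suml tpR mul1mx.
rewrite [X in _ = _ - X]mxE mulr_suml -sumrB; apply: eq_bigr => i _.
rewrite /dev adjmxB adjmxZ adjmx1 mulmxBl !mulmxBr -!scalemxAl -!scalemxAr.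
rewrite !mul1mx !mulmx1 !raddfB /= !mxtraceZ mxtrace_adj mxtrace1 adjmxE !mxE.
rewrite rmorphM /= fmorphV /= rmorph_nat.
by field.
Qed.

Lemma dev_norm : fnorm2 dev_mx = 1 - ent_fid V E Rc.
Proof.
apply: rcI; rewrite ent_fidE -env_norm rmorphB /= -!tr_gram dev_gram.
by rewrite raddfB.
Qed.

Lemma ent_fid_le1 : ent_fid V E Rc <= 1.
Proof. by rewrite -subr_ge0 -dev_norm fnorm2_ge0. Qed.

(** The zero block gives this factorization as many rows as [ideal_mx], so that the two can be
    subtracted. *)
Definition recovered_mx := col_mx (stack_mx *m noise_mx) (0 : 'M[C]_(r * K * K * K, m * K)).

(** The first block acts trivially on the code; the second supplies what its Gram matrix lacks to
    equal [Lambda_mx]. *)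
Definition ideal_mx := col_mx (rc kap *: kron K avg_mx) (rc kap *: kron K dev_mx).

Lemma gram_col_mx p1 p2 n (A : 'M[C]_(p1, n)) (B : 'M[C]_(p2, n)) :
  adjmx (col_mx A B) *m col_mx A B = adjmx A *m A + adjmx B *m B.
Proof. by rewrite /adjmx map_col_mx tr_col_mx mul_row_col. Qed.

Lemma recovered_gram : adjmx recovered_mx *m recovered_mx = Lambda_mx V E + B_mx V E.
Proof.
rewrite gram_col_mx mulmx0 addr0 adjmxM mulmxA -(mulmxA _ (adjmx stack_mx)).
by rewrite stack_gram mulmx1 noise_gram.
Qed.

Lemma ideal_gram : adjmx ideal_mx *m ideal_mx = Lambda_mx V E.
Proof.
rewrite gram_col_mx !adjmxZ -!scalemxAl -!scalemxAr -!scalerDr !kron_adj !kronM.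
rewrite -kronD dev_gram addrC subrK -env_kron_gram /env_kron adjmxZ.
by rewrite -scalemxAl -scalemxAr kron_adj kronM.
Qed.

(** The upper blocks differ by the entries of [dev_mx], and the lower block of [ideal_mx] has the
    same norm; each contributes [1 - ent_fid V E Rc]. *)
Lemma recovered_close : fnorm2 (recovered_mx - ideal_mx) = 2 * (1 - ent_fid V E Rc).
Proof.
rewrite opp_col_mx add_col_mx fnorm2_col_mx sub0r fnorm2N fnorm2_Z fnorm2_kron.
rewrite nsq_rc mulrA kap_sq mul1r mulr_natl mulr2n -dev_norm; congr (_ + _).
rewrite /fnorm2.
transitivity (\sum_i \sum_q \sum_u \sum_q' nsq (rc kap * dev i u q q')).
  rewrite -(sum_pidx (fun i q => \sum_u \sum_q' nsq (rc kap * dev i u q q'))).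
  apply: eq_bigr => b _; rewrite -(sum_pidx (fun u q' => nsq (rc kap * dev _ u _ q'))).
  apply: eq_bigr => k _; congr nsq.
  set i := (pidx b).1; set q := (pidx b).2; set u := (pidx k).1; set q' := (pidx k).2.
  have -> : (stack_mx *m noise_mx - rc kap *: kron K avg_mx) b k
      = (stack_mx *m noise_mx) b k - rc kap * kron K avg_mx b k.
    by rewrite [LHS]mxE [X in _ + X = _]mxE [X in _ - X = _]mxE.
  have -> : (stack_mx *m noise_mx) b k = rc kap * (Rc i *m E u *m V) q q'.
    rewrite -mulmxA 2!mxE mulr_sumr; apply: eq_bigr => a _.
    by rewrite [stack_mx _ _]mxE [noise_mx _ _]mxE; ring.
  have -> : dev i u q q' = (Rc i *m E u *m V) q q' - avg_mx i u * (q == q')%:R.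
    by rewrite [LHS]mxE [X in _ + X = _]mxE [X in _ - X = _]mxE [1%:M _ _]mxE.
  by rewrite -mulrBr [kron _ _ _ _]mxE.
under eq_bigr do under eq_bigr do rewrite exchange_big.
rewrite -(sum_pidx (fun i q => \sum_q' \sum_u nsq (rc kap * dev i u q q'))).
rewrite -(sum_pidx (fun b q' => \sum_u nsq (rc kap * dev (pidx b).1 u (pidx b).2 q'))).
by apply: eq_bigr => b _; apply: eq_bigr => u _; rewrite [dev_mx _ _]mxE.
Qed.

Lemma aqec_S_le (eta : R) : 0 < eta -> eta <= 1 ->
  aqec_S V E <= 3 * eta + 8 * (1 - ent_fid V E Rc) * (6 / eta + 8 * ln K%:R).
Proof.
move=> e0 e1.
have [U [p [dU p0]]] := gram_diag recovered_mx.
have [T [s [dT s0]]] := gram_diag ideal_mx.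
have NL (y : 'cV[C]_(m * K)) :
    fnorm2 (recovered_mx *m y) <= K%:R ^+ 2 * fnorm2 (ideal_mx *m y).
  rewrite (@gram_fnorm2 _ _ _ _ _ recovered_mx noise_mx) ?recovered_gram ?noise_gram //.
  rewrite (@gram_fnorm2 _ _ _ _ _ ideal_mx env_kron) ?ideal_gram ?env_kron_gram //.
  exact: noise_le_env.
have trN : \sum_i p i = 1.
  apply: rcI; rewrite -(tr_diagonalizes dU) recovered_gram -noise_gram tr_gram.
  by rewrite noise_norm.
have w1 : 1 <= K%:R ^+ 2 :> R by rewrite exprn_ege1 // ler1n.
have w0 : 0 <= K%:R ^+ 2 :> R by apply: le_trans w1.
(* Here [w = K^2] makes [4 ln w] into [8 ln K], and the factor 8 is 4 from [sqrt_overlap_le] times 2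
   from [recovered_close]. *)
have := relent_close dU dT p0 s0 w0 NL trN e0 e1 w1 (sqrt_overlap_le dU p0 dT s0).
rewrite recovered_gram ideal_gram recovered_close => /le_trans; apply.
rewrite lnXn ?ltr0n // mulr2n.
rewrite le_eqVlt; apply/orP; left; apply/eqP; ring.
Qed.

End Recovery.

(** * Nonnegativity of the entropy and construction of a recovery *)

Lemma aqec_S_ge0 : 0 <= aqec_S V E.
Proof.
have [U [p [dU p0]]] := gram_diag noise_mx.
have [T [s [dT s0]]] := gram_diag env_kron.
have trN : \sum_i p i = 1.
  by apply: rcI; rewrite -(tr_diagonalizes dU) tr_gram noise_norm.
have trL : \sum_i s i = 1.
  by apply: rcI; rewrite -(tr_diagonalizes dT) tr_gram env_kron_norm.
have A1 := affinity_le1 dU dT p0 s0 trN trL.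
have := relent_affinity dU dT p0 s0 noise_le_env trN.
rewrite noise_gram env_kron_gram; apply: le_trans.
by rewrite mulr_ge0 // subr_ge0.
Qed.

(* The [d] additional Kraus operators [|0><j| (1 - W^* W)] make the rows of [W] a channel
   as soon as [W^* W] is a projection. *)
Definition completed (W : 'M[C]_(m * K, d)) (i : 'I_(m + d)) : 'M[C]_(K, d) :=
  match fintype.split i with
  | inl u => \matrix_(q, a) W (mxvec_index u q) a
  | inr j => \matrix_(q, a) ((val q == 0)%:R * (1%:M - adjmx W *m W) j a)
  end.

Lemma completed_lshift W u :
  completed W (lshift d u) = \matrix_(q, a) W (mxvec_index u q) a.
Proof. by rewrite /completed (unsplitK (inl u)). Qed.

Lemma completed_tp (W : 'M[C]_(m * K, d)) :
  adjmx W *m W *m (adjmx W *m W) = adjmx W *m W -> kraus_tp (completed W).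
Proof.
set P := adjmx W *m W => PP; rewrite /kraus_tp big_split_ord /=.
have -> : \sum_i adjmx (completed W (lshift d i)) *m completed W (lshift d i) = P.
  apply/matrixP=> a a'; rewrite summxE [RHS]mxE.
  rewrite (eq_bigr (fun i => \sum_q adjmx W a (mxvec_index i q) * W (mxvec_index i q) a')).
    rewrite -(sum_pidx (fun i q => adjmx W a (mxvec_index i q) * W (mxvec_index i q) a')).
    by apply: eq_bigr => k _; rewrite pidxK.
  move=> i _; rewrite mxE; apply: eq_bigr => q _.
  by rewrite !adjmxE completed_lshift !mxE.
have Ph : adjmx P = P by rewrite adjmxM adjmxK.
set Q := 1%:M - P.
have QQ : adjmx Q *m Q = Q.
  by rewrite adjmxB adjmx1 Ph mulmxBl !mulmxBr !mul1mx mulmx1 PP subrr subr0.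
suff -> : \sum_j adjmx (completed W (rshift m j)) *m completed W (rshift m j) = Q.
  by rewrite addrC subrK.
rewrite -[RHS]QQ; apply/matrixP=> a a'; rewrite summxE [RHS]mxE; apply: eq_bigr => j _.
rewrite /completed (unsplitK (inr j)) mxE (bigD1 (Ordinal K_gt0)) //= big1 => [|q qn].
  by rewrite addr0 !adjmxE !mxE !mul1r.
rewrite adjmxE !mxE (_ : (val q == 0%N) = false) ?mul0r ?mulr0 //.
by apply/negbTE; apply: contraNneq qn => q0; apply/eqP/val_inj.
Qed.

(** The identity on the code index in [kron K al] leaves only the normalized traces that enter the
    fidelity. *)
Lemma recovery_correlation (W : 'M[C]_(m * K, d)) (al : 'M[C]_m) :
  \tr (W *m noise_mx *m (rc kap *: kron K al)) =
  \sum_i \sum_u \tr (completed W (lshift d i) *m E u *m V) / K%:R * al u i.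
Proof.
have -> : \sum_i \sum_u \tr (completed W (lshift d i) *m E u *m V) / K%:R * al u i
  = \sum_i \sum_q \sum_u rc kap * (W *m noise_mx) (mxvec_index i q) (mxvec_index u q) * al u i.
  apply: eq_bigr => i _; rewrite exchange_big; apply: eq_bigr => u _.
  rewrite -mulr_suml; congr (_ * _).
  rewrite -rc_kap_sq mulrC /mxtrace mulr_sumr; apply: eq_bigr => q _.
  rewrite -mulrA completed_lshift -mulmxA mxE; congr (_ * _).
  rewrite [RHS]mxE mulr_sumr; apply: eq_bigr => a _.
  by rewrite [noise_mx _ _]mxE mxvec_indexK [(\matrix_(_, _) _) _ _]mxE /=; ring.
rewrite -(sum_pidx (fun i q =>
  \sum_u rc kap * (W *m noise_mx) (mxvec_index i q) (mxvec_index u q) * al u i)).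
apply: eq_bigr => k _; rewrite mxE.
set i := (pidx k).1; set q := (pidx k).2.
transitivity (\sum_u \sum_q' rc kap * (W *m noise_mx) k (mxvec_index u q')
   * (al u i * (q' == q)%:R)).
  rewrite -(sum_pidx (fun u q' => rc kap * (W *m noise_mx) k (mxvec_index u q')
     * (al u i * (q' == q)%:R))).
  apply: eq_bigr => l _; rewrite pidxK.
  by rewrite [X in _ * X]mxE [kron _ _ _ _]mxE -/i -/q; ring.
apply: eq_bigr => u _; rewrite (bigD1 q) //= eqxx mulr1 big1 ?addr0 ?pidxK //.
by move=> q' /negPf ->; rewrite !mulr0.
Qed.

Lemma exists_recovery : exists r (Rc : 'I_r -> 'M[C]_(K, d)),
  kraus_tp Rc /\ 1 - aqec_S V E <= ent_fid V E Rc.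
Proof.
have [U [p [dU p0]]] := gram_diag noise_mx.
have [UY [y [dY y0]]] := gram_diag env_mx.
(* A product eigenbasis of [Lambda_mx] is used, so that its square root is again a Kronecker
   product, built from [al]. *)
pose s (k : 'I_(m * K)) := kap ^+ 2 * y (pidx k).1.
have s0 k : 0 <= s k by rewrite mulr_ge0 // sqr_ge0.
have dT : diagonalizes (adjmx env_kron *m env_kron) (kron K UY) s.
  have := diagonalizes_kron K (kap ^+ 2) dY.
  congr diagonalizes; rewrite /env_kron adjmxZ -scalemxAl -scalemxAr scalerA.
  by rewrite conj_rc kron_adj kronM expr2 rmorphM.
have trN : \sum_i p i = 1.
  by apply: rcI; rewrite -(tr_diagonalizes dU) tr_gram noise_norm.
have := relent_affinity dU dT p0 s0 noise_le_env trN.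
set A := (X in 2 * (1 - X) <= _); rewrite noise_gram env_kron_gram -/(aqec_S V E) => SA.
pose al := adjmx UY *m diagc (fun u => Num.sqrt (y u)) *m UY.
have [UU UU' UE] := dU; have [YY YY' YE] := dY.
have al1 : fnorm2 al = 1.
  rewrite -env_norm; apply: rcI; rewrite -!tr_gram; congr (\tr _).
  rewrite YE /al !adjmxM adjmxK adjmx_diagc !mulmxA -(mulmxA _ UY) YY mulmx1.
  rewrite -(mulmxA (adjmx UY)) diagcM; congr (_ *m _ *m _); apply: eq_diagc => u.
  by rewrite -expr2 sqr_sqrtr.
set W := adjmx U *m polar noise_mx U p.
have AE : rc A = \tr (W *m noise_mx *m (rc kap *: kron K al)).
  rewrite -tr_diag_overlap; congr (\tr (_ *m _)).
    by rewrite /W -[RHS]mulmxA (polar_gram dU p0) mulmxA.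
  have dal : diagonalizes al UY (fun u => Num.sqrt (y u)) by split.
  have [_ _ ->] := diagonalizes_kron K kap dal.
  congr (_ *m _ *m _); apply: eq_diagc => k; rewrite /s sqrtrM ?sqr_ge0 //.
  by rewrite sqrtr_sqr ger0_norm // invr_ge0 sqrtr_ge0.
exists (m + d)%N, (completed W); split.
  have WW : adjmx W *m W = adjmx (polar noise_mx U p) *m polar noise_mx U p.
    by rewrite /W adjmxM adjmxK -mulmxA (mulmxA U) UU mul1mx.
  by apply: completed_tp; rewrite WW (polar_proj dU p0).
pose t i u := \tr (completed W (lshift d i) *m E u *m V) / K%:R.
apply: (@le_trans _ _ (\sum_i \sum_u nsq (t i u))); last first.
  rewrite /ent_fid big_split_ord.
  apply: ler_wpDr.
    apply: sumr_ge0 => i _; apply: sumr_ge0 => u _.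
    by rewrite -nsqE Re_rc nsq_ge0.
  by apply: ler_sum => i _; apply: ler_sum => u _; rewrite -nsqE Re_rc.
(* Expanding this square bounds the fidelity below by [2 A - 1], since [al] has norm 1 and
   correlates with [t] to exactly [A]. *)
have : 0 <= \sum_i \sum_u nsq (t i u - (al u i)^*).
  by do 2![apply: sumr_ge0 => ? _]; apply: nsq_ge0.
have -> : \sum_i \sum_u nsq (t i u - (al u i)^*)
    = \sum_i \sum_u nsq (t i u) + \sum_i \sum_u nsq (al u i)
      - 2 * complex.Re (\sum_i \sum_u t i u * al u i).
  rewrite -big_split Re_sum mulr_sumr -sumrB; apply: eq_bigr => i _ /=.
  rewrite -big_split Re_sum mulr_sumr -sumrB; apply: eq_bigr => u _ /=.
  by rewrite nsqB nsq_conjC conjCK.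
rewrite -(recovery_correlation W al) -AE Re_rc.
rewrite [X in _ + X - _]exchange_big -/(fnorm2 al) al1 => T0.
apply: (@le_trans _ _ (2 * A - 1)); first by move: (aqec_S V E) SA => S; lra.
by rewrite -subr_ge0 opprB addrA.
Qed.

End SingleCode.

(** * Passage to the limit *)

(** The constant [c] may depend on [eta]: first [eta] is fixed so that [3 eta <= e / 2], and only
    then is [n] taken large. *)
Lemma cvg0_of_bound (R : realType) (u F : nat -> R) :
  (forall n, 0 <= u n) -> (F n @[n --> \oo] --> (1 : R)) ->
  (forall eta : R, 0 < eta -> eta <= 1 -> exists2 c : R, 0 <= c &
     \forall n \near \oo, u n <= 3 * eta + c * (1 - F n)) ->
  u n @[n --> \oo] --> (0 : R).
Proof.
move=> u0 F1 bound; apply/cvgr0Pnorm_le => e e0.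
pose eta := Num.min 1 (e / 6).
have eta0 : 0 < eta by rewrite lt_min ltr01 divr_gt0.
have eta1 : eta <= 1 by rewrite ge_min lexx.
have etae : eta <= e / 6 by rewrite ge_min lexx orbT.
have [c c0 uc] := bound eta eta0 eta1.
(* [c] may be 0, so the division uses [c + 1]. *)
have c1 : 0 < c + 1 by rewrite ltr_wpDl.
have e2 : 0 < e / 2 / (c + 1) by rewrite !divr_gt0.
have /cvgrPdist_le/(_ _ e2) F1e := F1.
near=> n; rewrite ger0_norm //.
have un : u n <= 3 * eta + c * (1 - F n) by near: n.
have Fn : `|1 - F n| <= e / 2 / (c + 1) by near: n.
apply: (le_trans un).
have : c * (1 - F n) <= e / 2.
  apply: (@le_trans _ _ ((c + 1) * `|1 - F n|)).
    apply: (@le_trans _ _ (c * `|1 - F n|)); first by rewrite ler_wpM2l ?ler_norm.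
    by rewrite ler_wpM2r // lerDl.
  by rewrite mulrC -ler_pdivlMr.
move: etae; lra.
Unshelve. all: by end_near. Qed.

Unset Implicit Arguments.

Theorem theorem1 (R : realType) (d K m : nat -> nat)
  (V : forall n, 'M[R[i]]_(d n, K n))
  (E : forall n, 'I_(m n) -> 'M[R[i]]_(d n)) :
  (forall n, (0 < K n)%N) ->
  (forall n, is_isometry (V n)) ->
  (forall n, kraus_tp (E n)) ->
  [/\
   (* (1) *)
   ((fun n => aqec_S (V n) (E n)) @ \oo --> (0 : R)) ->
     exists (r : nat -> nat) (Rc : forall n, 'I_(r n) -> 'M[R[i]]_(K n, d n)),
       (forall n, kraus_tp (Rc n)) /\
       ((fun n => ent_fid (V n) (E n) (Rc n)) @ \oo --> (1 : R)),
   (* (2) *)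
   (exists M : nat, forall n, (K n <= M)%N) ->
   ~ ((fun n => aqec_S (V n) (E n)) @ \oo --> (0 : R)) ->
     forall (r : nat -> nat) (Rc : forall n, 'I_(r n) -> 'M[R[i]]_(K n, d n)),
       (forall n, kraus_tp (Rc n)) ->
       ~ ((fun n => ent_fid (V n) (E n) (Rc n)) @ \oo --> (1 : R))
  & (* (3) *)
   (forall M : nat, \forall n \near \oo, (M <= K n)%N) ->
   ~ ((fun n => aqec_S (V n) (E n) / ln (K n)%:R) @ \oo --> (0 : R)) ->
     forall (r : nat -> nat) (Rc : forall n, 'I_(r n) -> 'M[R[i]]_(K n, d n)),
       (forall n, kraus_tp (Rc n)) ->
       ~ ((fun n => ent_fid (V n) (E n) (Rc n)) @ \oo --> (1 : R))].
Proof.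
move=> K_gt0 isoV tpE; split.
- move=> S0.
  pose f n := boolp.cid (exists_recovery (K_gt0 n) (isoV n) (tpE n)).
  pose g n := boolp.cid (projT2 (f n)).
  exists (fun n => projT1 (f n)), (fun n => projT1 (g n)); split.
    by move=> n; have [] := projT2 (g n).
  apply: (@squeeze_cvgr _ _ _ _ (fun n => 1 - aqec_S (V n) (E n)) (fun=> 1)).
  + apply: nearW => n; have [tp le] := projT2 (g n); apply/andP; split.
      exact: le.
    exact: (ent_fid_le1 (K_gt0 n) (isoV n) (tpE n) tp).
  + by rewrite -[X in _ --> X]subr0; apply: cvgB => //; apply: cvg_cst.
  + exact: cvg_cst.
- move=> [M KM] nS r Rc tpR F1; apply: nS.
  apply: (cvg0_of_bound _ F1) => [n|eta e0 e1]; first exact: aqec_S_ge0.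
  have M1 : (0 < M)%N := leq_trans (K_gt0 0%N) (KM 0%N).
  exists (8 * (6 / eta + 8 * ln M%:R)).
    by rewrite mulr_ge0 // addr_ge0 ?divr_ge0 ?mulr_ge0 ?ln_ge0 ?ler1n // ltW.
  apply: nearW => n.
  apply: (le_trans (aqec_S_le (K_gt0 n) (isoV n) (tpE n) (tpR n) e0 e1)).
  rewrite lerD2l mulrAC ler_wpM2r //.
    by rewrite subr_ge0 (ent_fid_le1 (K_gt0 n) (isoV n) (tpE n) (tpR n)).
  by rewrite ler_wpM2l // lerD2l ler_wpM2l // ler_ln ?posrE ?ltr0n // ler_nat.
- move=> Kinf nS r Rc tpR F1; apply: nS.
  have lnK n : 0 <= ln (K n)%:R :> R by rewrite ln_ge0 // ler1n.
  apply: (cvg0_of_bound _ F1) => [n|eta e0 e1].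
    by rewrite divr_ge0 // aqec_S_ge0.
  (* The bound is used at parameter 1: once [l = ln K] is at least [1 / eta >= 1], [3 / l <= 3 eta]
     and [(6 + 8 l) / l <= 14]. *)
  exists (8 * 14); first by rewrite mulr_ge0.
  near=> n.
  have ei : 1 <= eta^-1 by rewrite invf_ge1.
  have Kn : eta^-1 <= ln (K n)%:R.
    rewrite -[leLHS]expRK ler_ln ?posrE ?expR_gt0 ?ltr0n //.
    apply: (le_trans (ltW (archi_boundP (expR_ge0 _)))); rewrite ler_nat.
    by near: n; apply: Kinf.
  have lnK1 : 1 <= ln (K n)%:R :> R by apply: le_trans Kn.
  have lnKp : 0 < ln (K n)%:R :> R by apply: lt_le_trans lnK1.
  rewrite ler_pdivrMr //.
  apply: (le_trans (aqec_S_le (K_gt0 n) (isoV n) (tpE n) (tpR n) ltr01 (lexx 1))).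
  have F0 : 0 <= 1 - ent_fid (V n) (E n) (Rc n).
    by rewrite subr_ge0 (ent_fid_le1 (K_gt0 n) (isoV n) (tpE n) (tpR n)).
  have : 1 <= eta * ln (K n)%:R by rewrite mulrC -ler_pdivrMr // mul1r.
  have := mulr_ge0 F0 (_ : 0 <= ln (K n)%:R - 1); rewrite subr_ge0 => /(_ lnK1).
  move: (1 - ent_fid _ _ _) F0 (ln (K n)%:R) => D D0 l; lra.
Unshelve. all: by end_near. Qed.
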